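(* Let $(X,f)$ be a topological dynamical system. Suppose that $(X,f)$ is densely aperiodic and $\Omega_f = X$. Then every basic set $B$ of $(X,f)$ is continuously decisive, i.e., $\operatorname{int} B = \emptyset$.
   Context: A topological dynamical system $(X,f)$ is a non-empty compact Hausdorff space $X$ with a homeomorphism $f : X \to X$. For $x \in X$, $O(x) = \{f^n(x) \mid n \in \mathbb{Z}\}$, and for $A \subseteq X$, $O(A) = \bigcup_{n \in \mathbb{Z}} f^n(A)$. The interior of $A$ is denoted $\operatorname{int} A$. A point $x$ is aperiodic if $O(x)$ is infinite; $(X,f)$ is densely aperiodic if the set of aperiodic points is dense in $X$. A point $x \in X$ is wandering if there is an open set $U \ni x$ with $f^n(U) \cap U = \emptyset$ for all $n \ne 0$ ($n \in \mathbb{Z}$); $\Omega_f$ is the set of points that are not wandering. A closed set $A \subseteq X$ is a quasi-section if every open set $U \supseteq A$ satisfies $O(U) = X$. A closed set $A \subseteq X$ is a basic set if $A$ is a quasi-section and $|O(x) \cap A| \le 1$ for every $x \in X$. A quasi-section (in particular, a basic set) $B$ is continuously decisive if $\operatorname{int} B = \emptyset$. *)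

(* Defs.v *)
From mathcomp Require Export all_boot all_order all_algebra.
From mathcomp Require Export boolp classical_sets functions cardinality topology.

Set Implicit Arguments.
Unset Strict Implicit.
Unset Printing Implicit Defensive.

Local Open Scope classical_set_scope.

Record homeomorphism (X : topologicalType) := Homeomorphism {
  homeo_fun :> X -> X;
  homeo_inv : X -> X;
  homeo_funK : cancel homeo_fun homeo_inv;
  homeo_invK : cancel homeo_inv homeo_fun;
  homeo_fun_continuous : continuous homeo_fun;
  homeo_inv_continuous : continuous homeo_inv
}.

Section Dynamics.
Variables (X : topologicalType) (f : homeomorphism X).

(* [Negz k] denotes the integer - (k + 1). *)
Definition iterz (n : int) : X -> X :=
  match n with
  | Posz k => iter k f
  | Negz k => iter k.+1 (homeo_inv f)
  end.

Definition orbit_pt (x : X) : set X := range (fun n : int => iterz n x).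

Definition orbit_set (A : set X) : set X :=
  \bigcup_(n in [set: int]) (iterz n @` A).

Definition aperiodic (x : X) : Prop := infinite_set (orbit_pt x).

Definition densely_aperiodic : Prop := dense [set x | aperiodic x].

Definition wandering (x : X) : Prop :=
  exists U : set X, [/\ open U, U x &
    forall n : int, n <> 0%R -> (iterz n @` U) `&` U = set0].

Definition nonwandering_set : set X := [set x | ~ wandering x].

Definition quasi_section (A : set X) : Prop :=
  closed A /\
  forall U : set X, open U -> A `<=` U -> orbit_set U = [set: X].

Definition basic_set (A : set X) : Prop :=
  quasi_section A /\ forall x : X, is_subset1 (orbit_pt x `&` A).

Definition continuously_decisive (B : set X) : Prop :=
  quasi_section B /\ interior B = set0.

End Dynamics.

(* Main.v *)
Require Import Defs.

Local Open Scope classical_set_scope.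

(* On the open set [W] of the points [y] of [int B] with [f^n y] in [int B],
   for a fixed [n <> 0], the basic set [B] contains both [y] and [f^n y], so
   [f^n y = y]. Hence [W] consists of periodic points and is empty by density
   of the aperiodic ones; if [int B] were not empty, all its points would then
   be wandering. *)

Lemma iter_continuous (X : topologicalType) (g : X -> X) (k : nat) :
  continuous g -> continuous (iter k g).
Proof.
move=> gc; elim: k => [|k IHk] x; first exact: cvg_id.
exact: (continuous_comp (IHk x) (gc _)).
Qed.

Lemma iterK (T : Type) (g h : T -> T) (k : nat) :
  cancel g h -> cancel (iter k g) (iter k h).
Proof. by move=> gK; elim: k => [|k IHk] x //; rewrite iterSr iterS gK IHk. Qed.

Lemma iter_fixed_mul (T : Type) (g : T -> T) (m k : nat) (x : T) :
  iter m g x = x -> iter (k * m)%N g x = x.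
Proof. by move=> gx; elim: k => [|k IHk] //; rewrite mulSn iterD IHk. Qed.

Section PeriodicPoints.
Variables (X : topologicalType) (f : homeomorphism X).

Lemma iterz_continuous (n : int) : continuous (iterz f n).
Proof.
case: n => k; apply: iter_continuous;
  [exact: homeo_fun_continuous | exact: homeo_inv_continuous].
Qed.

(** Exponents only matter modulo the period [m], so the whole orbit lies in the image of [I_m]. *)
Lemma periodic_orbit_finite (m : nat) (x : X) :
  (0 < m)%N -> iter m f x = x -> finite_set (orbit_pt f x).
Proof.
move=> m_gt0 fx.
have modE k : iter k f x = iter (k %% m)%N f x.
  by rewrite [in LHS](divn_eq k m) addnC iterD (iter_fixed_mul _ _ _ _ _ fx).
apply: (@sub_finite_set _ _ ((fun k => iter k f x) @` `I_m)); last first.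
  exact/finite_image/finite_II.
have forward k : ((fun k => iter k f x) @` `I_m) (iter k f x).
  by exists (k %% m)%N; [rewrite /= ltn_mod | rewrite -modE].
move=> _ [[k|k] _ <-]; first exact: forward.
(* A backward iterate becomes a forward one: [k.+1 * m] is a multiple of the period and, as [m > 0],
   at least [k.+1], so the subtraction is not truncated. *)
suff -> : iterz f (Negz k) x = iter (k.+1 * m - k.+1)%N f x by exact: forward.
rewrite /iterz -[in LHS](iter_fixed_mul _ _ _ k.+1 _ fx).
by rewrite -[in LHS](subnKC (leq_pmulr k.+1 m_gt0)) iterD (iterK _ _ _ _ (@homeo_funK _ f)).
Qed.

Lemma iterz_fixed_orbit_finite (n : int) (x : X) :
  n <> 0%R -> iterz f n x = x -> finite_set (orbit_pt f x).
Proof.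
case: n => [[|k] // _|k _ fx]; first exact: periodic_orbit_finite.
(* For negative [n], applying [f] to both sides [k.+1] times gives a positive period. *)
apply: (@periodic_orbit_finite k.+1) => //.
by rewrite -[in LHS]fx (iterK _ _ _ _ (@homeo_invK _ f)).
Qed.

End PeriodicPoints.

Theorem theorem4p18 (X : topologicalType) (f : homeomorphism X)
  (X_nonempty : [set: X] !=set0)
  (X_compact : compact [set: X])
  (X_hausdorff : hausdorff_space X)
  (f_densely_aperiodic : densely_aperiodic f)
  (f_nonwandering : nonwandering_set f = [set: X]) :
  forall B : set X, basic_set f B -> continuously_decisive f B.
Proof.
move=> B [B_section B_orbit]; split=> //.
rewrite -subset0 => z Bz.
have : nonwandering_set f z by rewrite f_nonwandering.
(* The neighbourhood showing that [z] wanders is [interior B] itself. *)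
apply; exists (interior B); split=> //; first exact: open_interior.
move=> n n_neq0; rewrite -subset0 => _ [[y By <-] Bfy].
have W_open : open (interior B `&` iterz f n @^-1` interior B).
  apply: openI; first exact: open_interior.
  apply: open_comp (@open_interior _ B) => w _; exact: iterz_continuous.
(* The return of [y] makes the open set nonempty, so it contains an aperiodic [x], which need not be
   [y]. *)
have [|x [[Bx Bfx] x_aper]] := f_densely_aperiodic _ _ W_open.
  by exists y.
apply: x_aper; apply: (iterz_fixed_orbit_finite _ _ _ _ n_neq0).
(* [iterz f n x] and [x] are both points of [B] on the orbit of [x], hence equal. *)
apply: (B_orbit x); split; [by exists n | exact: interior_subset | | ].
  by exists (Posz 0).
exact: interior_subset.
Qed.
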